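(* Let $m,n\ge1$, $A\in\mathbb{Z}^{m\times n}$, $b\in\mathbb{Z}^m$, let $f\in\mathbb{R}[x]=\mathbb{R}[x_1,\ldots,x_n]$ be a polynomial of even degree $d>2$, and let $$f^*=\min\{\,f(x):\ Ax=b;\ x\in\{-1,1\}^n\,\}.$$ Let $\rho_f$ be the scalar defined in the context, and let $$\rho:=\min_{x\in\{-1,1\}^n}\ f(x)+(2\rho_f+1)\,\Vert Ax-b\Vert^2 .$$ If $f^*<+\infty$ then $f^*=\rho$. Moreover, $f^*=+\infty$ if and only if $\rho>\rho_f$.
   Context: $\Vert\cdot\Vert$ is the Euclidean norm, and $f^*=+\infty$ by convention when $\{x\in\{-1,1\}^n: Ax=b\}=\emptyset$. $M\succeq 0$ means that the symmetric matrix $M$ is positive semidefinite. For a real sequence $y=(y_\alpha)_{\alpha\in\mathbb{N}^n}$, the Riesz functional $L_y:\mathbb{R}[x]\to\mathbb{R}$ is $L_y\big(\sum_\alpha h_\alpha x^\alpha\big)=\sum_\alpha h_\alpha y_\alpha$. For $k\in\mathbb{N}$, the moment matrix $M_k(y)$ of order $k$ is the symmetric matrix with rows and columns indexed by $\{\alpha\in\mathbb{N}^n:|\alpha|\le k\}$ and entries $M_k(y)_{\alpha\beta}=L_y(x^{\alpha+\beta})=y_{\alpha+\beta}$. For a polynomial $g$, the localizing matrix $M_k(g\,y)$ of order $k$ is the symmetric matrix with the same index set and entries $M_k(g\,y)_{\alpha\beta}=L_y(g\,x^{\alpha+\beta})$. Let $d'=d/2$ and $g_j(x)=1-x_j^2$,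 $j=1,\ldots,n$. Define $$r^1_f=\min\{L_y(f):\ y_0=1,\ M_{d'}(y)\succeq0,\ M_{d'-1}(g_j\,y)=0,\ j=1,\ldots,n\},$$ $$r^2_f=\max\{L_y(f):\ y_0=1,\ M_{d'}(y)\succeq0,\ M_{d'-1}(g_j\,y)=0,\ j=1,\ldots,n\},$$ where $y_0=L_y(1)$ is the entry of $y$ indexed by $\alpha=0$ (these are the first semidefinite relaxations of the moment-SOS (Lasserre) hierarchy for $\min$, respectively $\max$, of $f$ over $\{-1,1\}^n$), and set $$\rho_f:=\max_{i=1,2}|r^i_f|.$$ *)

(* Defs.v *)
From mathcomp Require Import all_boot all_order all_algebra.
From mathcomp Require Import boolp classical_sets reals constructive_ereal.
(* The notations of mpoly are incompatible with those of mathcomp-analysis, so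
   its constants are used by name: [mpoly n R] is {mpoly R[n]}, [multinom n]
   is the type N^n of exponents, [bmultinom n b] is the finite type of
   exponents of degree < b, and [mpolyX R a] is the monomial x^a. *)
From mathcomp Require Import -(notations) mpoly.

Set Implicit Arguments.
Unset Strict Implicit.
Unset Printing Implicit Defensive.

Import Order.TTheory GRing.Theory Num.Theory.

Local Open Scope classical_set_scope.
Local Open Scope ring_scope.

(* The value is 0 when S has no least (resp. greatest) element. *)
Definition set_min (R : realType) (S : set R) : R := xget 0 (S `&` lbound S).
Definition set_max (R : realType) (S : set R) : R := xget 0 (S `&` ubound S).

Lemma set_min_eq (R : realType) (S : set R) (m : R) :
  S m -> lbound S m -> set_min S = m.
Proof.
move=> Sm lbm; apply: xget_unique => // r [Sr lbr].
by apply/le_anti/andP; split; [exact: lbr | exact: lbm].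
Qed.

Lemma set_max_eq (R : realType) (S : set R) (m : R) :
  S m -> ubound S m -> set_max S = m.
Proof.
move=> Sm ubm; apply: xget_unique => // r [Sr ubr].
by apply/le_anti/andP; split; [exact: ubm | exact: ubr].
Qed.

Definition set_min_infty (R : realType) (S : set R) : \bar R :=
  if `[< S = set0 >] then +oo%E else (set_min S)%:E.

(* The library norm on matrices is the sup norm, hence this definition. *)
Definition euclidean_norm (R : realType) (m : nat) (v : 'cV[R]_m) : R :=
  Num.sqrt (\sum_(i < m) v i 0 ^+ 2).

Definition psdmx (R : realType) (p : nat) (M : 'M[R]_p) : Prop :=
  M^T = M /\ forall v : 'cV[R]_p, 0 <= (v^T *m M *m v) 0 0.

Definition hypercube (R : realType) (n : nat) : set 'cV[R]_n :=
  [set x | forall i : 'I_n, x i 0 = -1 \/ x i 0 = 1].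

Definition mpoly_at (R : realType) (n : nat) (f : mpoly n R) (x : 'cV[R]_n) :
    R :=
  meval (fun i => x i 0) f.

Definition riesz (R : realType) (n : nat) (y : multinom n -> R)
    (h : mpoly n R) : R :=
  \sum_(a <- msupp h) mcoeff a h * y a.

Definition exponent (n k : nat) (i : 'I_#|{: bmultinom n k.+1}|) :
    multinom n :=
  bmnm (enum_val i).

Definition moment_mx (R : realType) (n k : nat) (y : multinom n -> R) :
    'M[R]_#|{: bmultinom n k.+1}| :=
  \matrix_(i, j) y (mnm_add (exponent i) (exponent j)).

Definition localizing_mx (R : realType) (n k : nat) (g : mpoly n R)
    (y : multinom n -> R) : 'M[R]_#|{: bmultinom n k.+1}| :=
  \matrix_(i, j)
    riesz y (g * mpolyX R (mnm_add (exponent i) (exponent j))).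

Definition cube_constraint (R : realType) (n : nat) (j : 'I_n) : mpoly n R :=
  1 - mpolyX R (mnm1 j) ^+ 2.

Definition relaxation_feasible (R : realType) (n k : nat) :
    set (multinom n -> R) :=
  [set y | [/\ y (@mnm0 n) = 1,
               psdmx (moment_mx k y) &
               forall j : 'I_n,
                 localizing_mx k.-1 (cube_constraint R j) y = 0]].

(* Below, d stands for the degree of f. *)
Definition relaxation_min (R : realType) (n d : nat) (f : mpoly n R) : R :=
  set_min [set riesz y f | y in @relaxation_feasible R n d./2].

Definition relaxation_max (R : realType) (n d : nat) (f : mpoly n R) : R :=
  set_max [set riesz y f | y in @relaxation_feasible R n d./2].

Definition relaxation_bound (R : realType) (n d : nat) (f : mpoly n R) : R :=
  Num.max `|relaxation_min d f| `|relaxation_max d f|.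

Definition residual (R : realType) (m n : nat) (A : 'M[int]_(m, n))
    (b : 'cV[int]_m) (x : 'cV[R]_n) : 'cV[R]_m :=
  map_mx intr A *m x - map_mx intr b.

Definition constrained_min (R : realType) (m n : nat) (A : 'M[int]_(m, n))
    (b : 'cV[int]_m) (f : mpoly n R) : \bar R :=
  set_min_infty
    [set mpoly_at f x | x in
      [set x | map_mx intr A *m x = map_mx intr b] `&` @hypercube R n].

Definition penalized_min (R : realType) (m n d : nat) (A : 'M[int]_(m, n))
    (b : 'cV[int]_m) (f : mpoly n R) : R :=
  set_min
    [set mpoly_at f x + (2 * relaxation_bound d f + 1)
                        * euclidean_norm (residual A b x) ^+ 2
    | x in @hypercube R n].

(* Main.v *)
Require Import Defs.
From mathcomp Require Import all_boot all_order all_algebra.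
From mathcomp Require Import boolp classical_sets functions reals.
From mathcomp Require Import constructive_ereal.
From mathcomp Require Import topology normedtype derive.
From mathcomp Require Import -(notations) ssrcomplements mpoly.
From mathcomp Require Import zify lra.

Set Implicit Arguments.
Unset Strict Implicit.
Unset Printing Implicit Defensive.

Import Order.TTheory GRing.Theory Num.Theory.
Import numFieldNormedType.Exports.

Local Open Scope classical_set_scope.
Local Open Scope ring_scope.

(** Why the theorem holds.

    The penalty argument rests on |f| <= rho_f on the cube.  A vertex x that
    violates Ax = b has a nonzero integer residual, so its squared norm is at
    least 1 and the penalized objective is at least
    f(x) + 2 rho_f + 1 >= rho_f + 1.  A vertex with Ax = b pays nothing, and
    its value f(x) is at most rho_f.  Hence, as soon as a feasible vertex
    exists, the penalized minimum is reached among the feasible vertices and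
    equals f* <= rho_f; if there is none, the penalized minimum exceeds rho_f.

    The bound |f| <= rho_f ([cube_le_relaxation_bound]) says that the values of
    f on the cube lie between the optimal values of the two relaxations:
    evaluation at a vertex is a feasible moment sequence
    ([point_feasible]).  The real content is that these optimal values are
    attained ([relaxation_attained]).  Write d = 2k.  The localizing
    constraints say that y_c = y_(c + 2 e_j) whenever |c| <= 2k - 2, so every
    diagonal moment y_(2a), |a| <= k, descends to y_0 = 1; positivity of the
    2 x 2 minors of the moment matrix then gives |y_c| <= 1 for all |c| <= 2k
    ([feasible_norm_le1]).  Higher moments occur neither in the constraints nor
    in L_y(f), and may be set to 0.  What remains is a closed subset of a
    product of segments [-1, 1], compact by Tychonoff, on which y |-> L_y(f) is
    continuous. *)

(** * Exponents *)

Lemma mdeg_peel n (c : multinom n) :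
  (0 < mdeg c)%N -> exists j c', c = mnm_add c' (mnm1 j).
Proof.
move=> c_gt0.
have [j cj_gt0] : exists j, (0 < c j)%N.
  apply/not_existsP => c0; move: c_gt0; rewrite mdegE big1// => j _.
  by apply/eqP; rewrite -leqn0 leqNgt; apply/negP/c0.
exists j, (mnm_sub c (mnm1 j)); apply/mnmP => i.
rewrite mnmDE mnmBE mnm1E; case: eqP => [<-|_]; lia.
Qed.

(** Entries of a moment matrix of order k are indexed by pairs (a, b); this is
    what makes every moment of degree at most 2k appear as such an entry. *)
Lemma mdeg_split n p q (c : multinom n) : (mdeg c <= p + q)%N ->
  exists a b, [/\ c = mnm_add a b, (mdeg a <= p)%N & (mdeg b <= q)%N].
Proof.
elim: p c => [|p IHp] c c_le; first by exists (@mnm0 n), c; rewrite add0m mdeg0.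
have [c_le'|c_gt] := leqP (mdeg c) (p + q).
  by have [a [b [-> ? ?]]] := IHp _ c_le'; exists a, b; split => //; lia.
have [|j [c' cE]] := @mdeg_peel _ c; first by lia.
move: c_le; rewrite cE mdegD mdeg1 => c_le.
have [|a [b [c'E a_le b_le]]] := IHp c'; first by lia.
exists (mnm_add a (mnm1 j)), b; rewrite mdegD mdeg1; split => //; last by lia.
by rewrite c'E -!addmA (addmC b).
Qed.

Lemma exponent_mdeg n k (i : 'I_#|{: bmultinom n k.+1}|) :
  (mdeg (exponent i) <= k)%N.
Proof. by rewrite -ltnS bmdeg. Qed.

Lemma exponent_surj n k (a : multinom n) : (mdeg a <= k)%N ->
  exists i : 'I_#|{: bmultinom n k.+1}|, exponent i = a.
Proof.
rewrite -ltnS => a_lt; exists (enum_rank (BMultinom a_lt)).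
by rewrite /exponent enum_rankK.
Qed.

(** * The Riesz functional *)

Section Riesz.
Variables (R : realType) (n : nat).
Implicit Types (y : multinom n -> R) (h : mpoly n R) (c : multinom n).

(** Summing over a fixed index set, rather than over the support of the
    polynomial, makes linearity a termwise fact. *)
Lemma riesz_widen y h k : (msize h <= k)%N ->
  riesz y h = \sum_(a : bmultinom n k) mcoeff a h * y a.
Proof.
move=> h_le; pose I : subFinType _ := bmultinom n k.
rewrite /riesz (big_mksub I) /=; first last.
- by move=> a /msize_mdeg_lt /leq_trans; apply.
- exact: msupp_uniq.
- by rewrite big_rmcond// => a /memN_msupp_eq0 ->; rewrite mul0r.
Qed.

Lemma rieszB y g h : riesz y (g - h) = riesz y g - riesz y h.
Proof.
pose k := maxn (msize (g - h)) (maxn (msize g) (msize h)).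
rewrite !(@riesz_widen _ _ k) /k; try by lia.
by rewrite -sumrB; apply: eq_bigr => a _; rewrite mcoeffB mulrBl.
Qed.

Lemma riesz_mpolyX y c : riesz y (mpolyX R c) = y c.
Proof. by rewrite /riesz msuppX big_seq1 mcoeffX eqxx mul1r. Qed.

Lemma riesz_cube_constraint y j c :
  riesz y (cube_constraint R j * mpolyX R c) =
  y c - y (mnm_add c (mnm_add (mnm1 j) (mnm1 j))).
Proof.
rewrite /cube_constraint mulrBl mul1r rieszB expr2 -!mpolyXD !riesz_mpolyX.
by rewrite [mnm_add _ c]addmC.
Qed.

Lemma eq_riesz y z h : (forall c, (mdeg c < msize h)%N -> y c = z c) ->
  riesz y h = riesz z h.
Proof.
move=> yz; rewrite /riesz !big_seq; apply: eq_bigr => c c_h.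
by rewrite yz// msize_mdeg_lt.
Qed.

Lemma riesz_eval (x : 'cV[R]_n) h :
  riesz (fun c => \prod_i x i 0 ^+ c i) h = mpoly_at h x.
Proof. by []. Qed.

End Riesz.

(** * Feasible moment sequences *)

(** Evaluate the form at e_i + e_j and e_i - e_j. *)
Lemma psdmx_offdiag (R : realType) p (M : 'M[R]_p) i j :
  psdmx M -> `|M i j| *+ 2 <= M i i + M j j.
Proof.
move=> [Msym Mpsd].
have Mji : M j i = M i j by rewrite -[in LHS]Msym mxE.
have form s : 0 <= M i i + s * M i j *+ 2 + s ^+ 2 * M j j.
  have := Mpsd (delta_mx i 0 + s *: delta_mx j 0).
  rewrite [(_ + _)^T]raddfD /= [(_ *: _)^T]linearZ /= !trmx_delta.
  rewrite !mulmxDl !mulmxDr -!scalemxAl.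
  rewrite -!scalemxAr -!rowE -!colE !mxE Mji.
  lra.
have := form 1; have := form (-1); move: (M i i) (M j j) (M i j) => a b c.
by have [?|?] := ger0P c; lra.
Qed.

Section Moments.
Variables (R : realType) (n : nat).
Implicit Types (y : multinom n -> R).

Lemma moment_mx_sym k y : (moment_mx k y)^T = moment_mx k y.
Proof. by apply/matrixP => i j; rewrite !mxE addmC. Qed.

(** The entries of the localizing matrix are the differences
    y_(a+b) - y_(a+b+2e_j), and a + b covers all exponents of degree <= 2k. *)
Lemma localizing_mx_eq0P k y j :
  localizing_mx k (cube_constraint R j) y = 0 <->
  forall c, (mdeg c <= k.*2)%N ->
    y (mnm_add c (mnm_add (mnm1 j) (mnm1 j))) = y c.
Proof.
split=> [loc0 c|y_per].
  rewrite -addnn => /mdeg_split[a [b [-> a_le b_le]]].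
  have [r <-] := exponent_surj a_le; have [s <-] := exponent_surj b_le.
  move/matrixP/(_ r s): loc0; rewrite !mxE riesz_cube_constraint => /eqP.
  by rewrite subr_eq0 => /eqP <-.
apply/matrixP => r s; rewrite !mxE riesz_cube_constraint y_per ?subrr//.
by rewrite mdegD -addnn leq_add// exponent_mdeg.
Qed.

End Moments.

Section Feasible.
Variables (R : realType) (n k : nat).
Implicit Types (y : multinom n -> R) (c : multinom n).

(** Removing e_j from c lowers the index 2c by 2e_j, which the localizing
    constraints allow, down to y_0 = 1. *)
Lemma feasible_square y c : relaxation_feasible k y -> (mdeg c <= k)%N ->
  y (mnm_add c c) = 1.
Proof.
move=> [y0 _ loc]; elim: {c}(mdeg c) {-2}c (erefl (mdeg c))
  => [|p IHp] c cE c_le.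
  by move/eqP: cE; rewrite mdeg_eq0 => /eqP ->; rewrite addm0.
have [|j [c' c'E]] := @mdeg_peel _ c; first by lia.
move: cE c_le; rewrite c'E mdegD mdeg1 => cE c_le.
have -> : mnm_add (mnm_add c' (mnm1 j)) (mnm_add c' (mnm1 j)) =
          mnm_add (mnm_add c' c') (mnm_add (mnm1 j) (mnm1 j)).
  by apply/mnmP => i; rewrite !mnmDE; lia.
have /localizing_mx_eq0P -> := loc j; first by apply: IHp; lia.
by rewrite mdegD; lia.
Qed.

Lemma feasible_norm_le1 y c : relaxation_feasible k y -> (mdeg c <= k.*2)%N ->
  `|y c| <= 1.
Proof.
move=> y_feas; rewrite -addnn => /mdeg_split[a [b [-> a_le b_le]]].
have [r ra] := exponent_surj a_le; have [s sb] := exponent_surj b_le.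
have [_ /(psdmx_offdiag r s) + _] := y_feas.
rewrite !mxE ra sb !feasible_square//; lra.
Qed.

(** The localizing matrices of order k - 1 involve exponents of degree at most
    2 + 2 (k - 1) = 2k; for k = 0 the truncated predecessor would break
    this bound. *)
Lemma eq_feasible y z : (0 < k)%N ->
  (forall c, (mdeg c <= k.*2)%N -> y c = z c) ->
  relaxation_feasible k y -> relaxation_feasible k z.
Proof.
move=> k_gt0 yz [y0 y_psd loc]; split=> [||j].
- by rewrite -yz ?mdeg0.
- suff <- : moment_mx k y = moment_mx k z by [].
  apply/matrixP => r s; rewrite !mxE yz// mdegD -addnn.
  by rewrite leq_add ?exponent_mdeg.
- apply/localizing_mx_eq0P => c c_le; have /localizing_mx_eq0P y_per := loc j.
  by rewrite -!yz ?y_per// ?mdegD ?mdeg1; lia.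
Qed.

(** The moment matrix of a point mass is the rank-one matrix u u^T, where u
    lists the monomials at x, and x_j^2 = 1 kills the localizing matrices. *)
Lemma point_feasible (x : 'cV[R]_n) : hypercube x ->
  relaxation_feasible k (fun c => \prod_i x i 0 ^+ c i).
Proof.
move=> x_cube; split=> [||j].
- by rewrite big1// => i _; rewrite mnm0E expr0.
- split=> [|v]; first exact: moment_mx_sym.
  pose w := \sum_i v i 0 * \prod_l x l 0 ^+ (exponent i : multinom n) l.
  suff -> : (v^T *m moment_mx k (fun c => \prod_i x i 0 ^+ c i) *m v) 0 0
            = w ^+ 2 by exact: sqr_ge0.
  rewrite mxE expr2 /w mulr_sumr; apply: eq_bigr => s _.
  rewrite mxE !mulr_suml; apply: eq_bigr => r _; rewrite !mxE.
  under eq_bigr do rewrite mnmDE exprD.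
  rewrite big_split /=; lra.
- apply/localizing_mx_eq0P => c _; under eq_bigr do rewrite mnmDE exprD.
  rewrite big_split /= [X in _ * X]big1 ?mulr1// => i _.
  rewrite mnmDE addnn -mul2n exprM.
  by case: (x_cube i) => ->; rewrite ?sqrrN !expr1n.
Qed.

End Feasible.

(** * Compactness of the relaxation *)

Lemma continuous_sum (R : realType) (T : topologicalType) (I : Type)
    (r : seq I) (F : I -> T -> R) :
  (forall i, continuous (F i)) -> continuous (fun x => \sum_(i <- r) F i x).
Proof.
move=> F_cont x; rewrite /continuous_at; elim: r => [|i r IHr].
  by rewrite big_nil; under eq_cvg do rewrite big_nil; exact: cvg_cst.
rewrite big_cons; under eq_cvg do rewrite big_cons.
by apply: cvgD; [exact: F_cont | exact: IHr].
Qed.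

Lemma continuous_mull (R : realType) (T : topologicalType) (a : R)
    (g : T -> R) :
  continuous g -> continuous (fun x => a * g x).
Proof. by move=> g_cont x; apply: cvgM; [exact: cvg_cst | exact: g_cont]. Qed.

Section Compactness.
Import ArrowAsProduct.
Variables (R : realType) (n : nat).
Implicit Types (y : multinom n -> R).

Lemma continuous_moment (c : multinom n) :
  continuous (fun y : multinom n -> R => y c).
Proof. exact: (@proj_continuous _ (fun=> R) c). Qed.

Lemma continuous_riesz h : continuous (fun y : multinom n -> R => riesz y h).
Proof.
apply: (continuous_sum (F := fun a (y : multinom n -> R) => mcoeff a h * y a)).
by move=> a; exact: continuous_mull (@continuous_moment a).
Qed.

Lemma continuous_moment_form k (v : 'cV[R]_#|{: bmultinom n k.+1}|) :
  continuous (fun y : multinom n -> R => (v^T *m moment_mx k y *m v) 0 0).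
Proof.
have -> : (fun y : multinom n -> R => (v^T *m moment_mx k y *m v) 0 0) =
    fun y => \sum_s \sum_r
      v s 0 * v r 0 * y (mnm_add (exponent r) (exponent s)).
  apply/funext => y; rewrite mxE; apply: eq_bigr => s _; rewrite mxE mulr_suml.
  by apply: eq_bigr => r _; rewrite !mxE mulrC mulrA.
apply: (continuous_sum (F := fun s (y : multinom n -> R) => \sum_r _)) => s.
apply: (continuous_sum (F := fun r (y : multinom n -> R) => _ * y _)) => r.
exact: continuous_mull (@continuous_moment _).
Qed.

(** Feasibility is a conjunction of conditions on single continuous functions
    of y: one for y_0, one for each test vector v and one for each localizing
    entry. *)
Lemma closed_feasible k : closed (@relaxation_feasible R n k).
Proof.
have -> : @relaxation_feasible R n k =
    [set y : multinom n -> R | y (@mnm0 n) = 1]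
    `&` \bigcap_(v in [set: 'cV[R]_#|{: bmultinom n k.+1}|])
          [set y : multinom n -> R | 0 <= (v^T *m moment_mx k y *m v) 0 0]
    `&` \bigcap_(p in [set: 'I_n * 'I_#|{: bmultinom n k.-1.+1}| *
                                  'I_#|{: bmultinom n k.-1.+1}|])
          [set y : multinom n -> R |
             localizing_mx k.-1 (cube_constraint R p.1.1) y p.1.2 p.2 = 0].
  apply/seteqP; split=> [y [y0 [_ y_psd] loc]|y [[y0 y_psd] loc]].
    by split=> [|p _ /=]; [split=> // v _; exact: y_psd | rewrite loc mxE].
  split=> // [|j]; first by split=> [|v]; [exact: moment_mx_sym | exact: y_psd].
  by apply/matrixP => r s; rewrite [RHS]mxE; exact: (loc (j, r, s)).
apply: closedI; first apply: closedI.
- by have /continuous_closedP/(_ _ (@closed_eq R 1)) :=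
    @continuous_moment (@mnm0 n).
- apply: closed_bigI => v _.
  by have /continuous_closedP/(_ _ (@closed_ge R 0)) :=
    @continuous_moment_form _ v.
- apply: closed_bigI => -[[j r] s] _ /=; under eq_set do rewrite mxE.
  have /continuous_closedP/(_ _ (@closed_eq R 0)) := @continuous_riesz
    (cube_constraint R j * mpolyX R (mnm_add (exponent r) (exponent s))).
  by [].
Qed.

(** Feasibility leaves the moments of large degree free, so compactness
    requires bounding them as well. *)
Lemma compact_feasible k : compact
  (@relaxation_feasible R n k `&` [set y | forall c, `|y c| <= 1]).
Proof.
rewrite setIC; apply: compact_closedI; last exact: closed_feasible.
have -> : [set y : multinom n -> R | forall c, `|y c| <= 1] =
          [set y | forall c, `[-1, 1]%classic (y c)].
  apply/seteqP; split=> y y_le c; have := y_le c;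
    by rewrite /= in_itv /= ler_norml.
apply: (@tychonoff _ (fun=> R) (fun=> `[-1, 1]%classic)) => c.
exact: segment_compact.
Qed.

Definition truncate k y : multinom n -> R :=
  fun c => if (mdeg c <= k)%N then y c else 0.

Lemma truncate_feasible k y : (0 < k)%N -> relaxation_feasible k y ->
  relaxation_feasible k (truncate k.*2 y) /\
  forall c, `|truncate k.*2 y c| <= 1.
Proof.
move=> k_gt0 y_feas; split=> [|c].
  by apply: eq_feasible y_feas => // c c_le; rewrite /truncate c_le.
rewrite /truncate; case: ifP => [|_]; first exact: feasible_norm_le1.
by rewrite normr0 ler01.
Qed.

(** Truncation sends every feasible sequence into the compact set without
    changing the objective, so extremal values over that set are extremal over
    the whole relaxation. *)
Lemma relaxation_attained k (f : mpoly n R) :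
    (0 < k)%N -> (msize f <= k.*2.+1)%N ->
  exists lo hi, [/\ relaxation_feasible k lo, relaxation_feasible k hi &
    forall y, relaxation_feasible k y -> riesz lo f <= riesz y f <= riesz hi f].
Proof.
move=> k_gt0 f_le.
set K := @relaxation_feasible R n k `&` [set y | forall c, `|y c| <= 1].
have K0 : K !=set0.
  have ones_cube : hypercube (const_mx 1 : 'cV[R]_n).
    by move=> i; right; rewrite mxE.
  by eexists; apply: truncate_feasible (point_feasible k ones_cube).
have cont := continuous_subspaceT (A := K) (@continuous_riesz f).
have [lo loK lo_min] := compact_EVT_min K0 (@compact_feasible k) cont.
have [hi hiK hi_max] := compact_EVT_max K0 (@compact_feasible k) cont.
exists lo, hi; split; [by case/set_mem: loK | by case/set_mem: hiK |].
move=> y y_feas.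
have -> : riesz y f = riesz (truncate k.*2 y) f.
  by apply: eq_riesz => c c_lt; rewrite /truncate -ltnS (leq_trans c_lt f_le).
have tK : truncate k.*2 y \in K by apply/mem_set/truncate_feasible.
by rewrite lo_min ?hi_max.
Qed.

End Compactness.

(** Attainment matters here: the optimal values are true bounds only because
    they are a least and a greatest element, which identifies them with the
    values at [lo] and [hi]. *)
Lemma cube_le_relaxation_bound (R : realType) (n d : nat) (f : mpoly n R) x :
    (msize f <= d.+1)%N -> ~~ odd d -> (0 < d)%N -> hypercube x ->
  `|mpoly_at f x| <= relaxation_bound d f.
Proof.
move=> f_le d_even d_gt0 x_cube.
have dE : d = d./2.*2 by rewrite even_halfK.
have [||lo [hi [lo_feas hi_feas lo_hi]]] := @relaxation_attained R n d./2 f.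
- by lia.
- by rewrite -dE.
have minE : relaxation_min d f = riesz lo f.
  by apply: set_min_eq; [exists lo | move=> _ [y /lo_hi/andP[? _] <-]].
have maxE : relaxation_max d f = riesz hi f.
  by apply: set_max_eq; [exists hi | move=> _ [y /lo_hi/andP[_ ?] <-]].
have := lo_hi _ (point_feasible d./2 x_cube).
rewrite riesz_eval /relaxation_bound minE maxE le_max.
case: (ger0P (riesz lo f)); case: (ger0P (riesz hi f));
  case: (ger0P (mpoly_at f x)).
all: by move=> ? ? ? /andP[? ?]; apply/orP; (left; lra) || (right; lra).
Qed.

(** * The penalty *)

(** The cube is finite, its vertices being indexed by sign patterns. *)
Lemma cube_argmin (R : realType) n (P : set 'cV[R]_n) (g : 'cV[R]_n -> R) :
  P `<=` @hypercube R n -> P !=set0 ->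
  exists2 x, P x & forall z, P z -> g x <= g z.
Proof.
move=> P_cube [x0 Px0].
pose vertex (s : {ffun 'I_n -> bool}) : 'cV[R]_n := \col_i (-1) ^+ s i.
have vertexP z : P z -> z = vertex [ffun i => z i 0 == -1].
  move=> Pz; apply/matrixP => i j; rewrite ord1 mxE ffunE.
  case: eqP => [-> //|z_neq]; by case: (P_cube z Pz i).
have Pv0 : `[< P (vertex [ffun i => x0 i 0 == -1]) >].
  by apply/asboolP; rewrite -vertexP.
case: (@arg_minP _ _ _ _ (fun s => `[< P (vertex s) >])
  (fun s => g (vertex s)) Pv0) => s /asboolP Ps s_min.
exists (vertex s) => // z Pz; rewrite (vertexP z Pz); apply: s_min.
by apply/asboolP; rewrite -vertexP.
Qed.

Lemma sqr_euclidean_norm (R : realType) m (v : 'cV[R]_m) :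
  euclidean_norm v ^+ 2 = \sum_i v i 0 ^+ 2.
Proof. by rewrite sqr_sqrtr// sumr_ge0// => i _; exact: sqr_ge0. Qed.

Lemma int_euclidean_norm_ge1 (R : realType) m (v : 'cV[R]_m) :
  (forall i, v i 0 \is a Num.int) -> v != 0 -> 1 <= euclidean_norm v ^+ 2.
Proof.
move=> v_int /eqP v_neq0; rewrite sqr_euclidean_norm.
have [i vi_neq0] : exists i, v i 0 != 0.
  apply/not_existsP => v0; apply: v_neq0; apply/matrixP => i j.
  by rewrite ord1 mxE; apply/eqP; rewrite -[_ == _]negbK; apply/negP/v0.
rewrite (bigD1 i)//= ler_wpDr ?sumr_ge0// => [j _|]; first exact: sqr_ge0.
by rewrite -real_normK ?num_real// expr_ge1// norm_intr_ge1.
Qed.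

Lemma residual_int (R : realType) m n (A : 'M[int]_(m, n)) b (x : 'cV[R]_n) i :
  hypercube x -> residual A b x i 0 \is a Num.int.
Proof.
move=> x_cube; rewrite !mxE rpredB// ?rpred_sum// => [j _|]; last first.
  exact: intr_int.
rewrite mxE rpredM// ?intr_int//.
by case: (x_cube j) => ->; rewrite ?rpredN rpred1.
Qed.

Theorem lemma2p4 (R : realType) (m n d : nat) (A : 'M[int]_(m, n))
    (b : 'cV[int]_m) (f : mpoly n R)
    (m_ge1 : (1 <= m)%N) (n_ge1 : (1 <= n)%N)
    (f_degree : msize f = d.+1) (d_even : ~~ odd d) (d_gt2 : (2 < d)%N) :
  ((constrained_min A b f < +oo)%E ->
     constrained_min A b f = (penalized_min d A b f)%:E) /\
  (constrained_min A b f = +oo%E <->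
     relaxation_bound d f < penalized_min d A b f).
Proof.
set rho_f := relaxation_bound d f.
have f_bound x : hypercube x -> - rho_f <= mpoly_at f x <= rho_f.
  by move=> x_cube; rewrite -ler_norml cube_le_relaxation_bound ?f_degree//; lia.
pose feas : set 'cV[R]_n :=
  [set x | map_mx intr A *m x = map_mx intr b] `&` @hypercube R n.
pose F (x : 'cV[R]_n) : R :=
  mpoly_at f x + (2 * rho_f + 1) * euclidean_norm (residual A b x) ^+ 2.
have F_feas x : feas x -> F x = mpoly_at f x.
  move=> [/= Ax _]; rewrite /F /residual Ax subrr sqr_euclidean_norm.
  by rewrite big1 ?mulr0 ?addr0// => i _; rewrite mxE expr0n.
have F_infeas x : hypercube x -> ~ feas x -> rho_f < F x.
  move=> x_cube x_infeas.
  have res_neq0 : residual A b x != 0.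
    by apply/eqP => /eqP; rewrite subr_eq0 => /eqP Ax; exact: x_infeas.
  have := int_euclidean_norm_ge1 (fun i => residual_int A b i x_cube) res_neq0.
  rewrite /F; move: (_ ^+ 2) => N N_ge1; have /andP[? ?] := f_bound x x_cube.
  have : (2 * rho_f + 1) * 1 <= (2 * rho_f + 1) * N by rewrite ler_wpM2l//; lra.
  lra.
have penalized_minE x : hypercube x -> (forall z, hypercube z -> F x <= F z) ->
    penalized_min d A b f = F x.
  move=> x_cube x_min; apply: set_min_eq; first by exists x.
  by move=> _ [z /x_min ? <-].
have [feas0|/eqP/set0P feas_neq0] := pselect (feas = set0).
  have -> : constrained_min A b f = +oo%E.
    rewrite /constrained_min -/feas /set_min_infty feas0 image_set0.
    by rewrite asboolT.
  split=> //; split=> // _.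
  have [||x x_cube x_min] := @cube_argmin R n (@hypercube R n) F => //.
    by exists (const_mx 1) => i; right; rewrite mxE.
  rewrite (penalized_minE x)//; apply: F_infeas => //.
  by rewrite feas0.
have [|x x_feas x_min] := @cube_argmin R n feas (mpoly_at f) _ feas_neq0.
  by move=> x [].
have x_cube : hypercube x by case: x_feas.
have -> : constrained_min A b f = (mpoly_at f x)%:E.
  rewrite /constrained_min -/feas /set_min_infty asboolF.
    congr (_%:E); apply: set_min_eq; first by exists x.
    by move=> _ [z /x_min ? <-].
  by move=> im0; have : [set mpoly_at f z | z in feas] (mpoly_at f x);
    [exists x | rewrite im0].
have -> : penalized_min d A b f = mpoly_at f x.
  rewrite -F_feas//; apply: penalized_minE => // z z_cube; rewrite F_feas//.
  have [z_feas|/F_infeas] := pselect (feas z); first by rewrite F_feas ?x_min.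
  by move=> /(_ z_cube)/ltW; apply: le_trans; have /andP[] := f_bound x x_cube.
split=> //; split=> //.
by rewrite ltNge; have /andP[_ ->] := f_bound x x_cube.
Qed.
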